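(* Let $2\le s\le r$ be fixed integers with $r$ sufficiently large in terms of $s$. If $\Gamma$ is a Paley graph with a square number $n$ of vertices, then $\mathrm{ex}(\Gamma,\mathcal{P}_{K_{s,r}})=\Theta(n^{2-1/(2s)})$.
   Context: For a prime power $q\equiv 1 \pmod 4$, the Paley graph $P_q$ has vertex set the finite field with $q$ elements, two distinct vertices being adjacent if their difference is a (nonzero) square. For a graph $H$, $\mathcal{P}_H$ is the property of not containing $H$ as an induced subgraph, and $\mathrm{ex}(\Gamma,\mathcal{P})$ is the maximum number of edges of a subgraph $G\subseteq\Gamma$ that belongs to $\mathcal{P}$. The implicit constants in $\Theta$ may depend on $s,r$. *)

(* Defs.v *)
From HB Require Import structures.
From mathcomp Require Import all_boot all_order all_algebra all_field.
From mathcomp Require Import all_classical all_reals all_analysis.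
From mathcomp Require Import Rstruct.
Set Implicit Arguments. Unset Strict Implicit. Unset Printing Implicit Defensive.
Import Order.TTheory GRing.Theory Num.Theory.
Local Open Scope ring_scope.

(* Graphs on a finite vertex type V are given by their (ordered) arc sets
   E : {set V * V}; a simple graph has a symmetric irreflexive arc set. *)
Definition simple_graph (V : finType) (E : {set V * V}) : bool :=
  [forall x : V, (x, x) \notin E] &&
  [forall x : V, forall y : V, ((x, y) \in E) == ((y, x) \in E)].

Definition nedges (V : finType) (E : {set V * V}) : nat := (#|E| %/ 2)%N.

Definition paley (F : finFieldType) : {set F * F} :=
  [set p : F * F | (p.1 != p.2) && [exists z : F, z ^+ 2 == p.1 - p.2]].

Definition induced_sub (V W : finType) (H : {set W * W}) (G : {set V * V}) : Prop :=
  exists phi : W -> V, injective phi /\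
    forall u v : W, ((u, v) \in H) = ((phi u, phi v) \in G).

Definition Kbip (s r : nat) : {set ('I_s + 'I_r) * ('I_s + 'I_r)} :=
  [set p | match p.1, p.2 with
           | inl _, inr _ => true
           | inr _, inl _ => true
           | _, _ => false end].

Definition ex_ind_Ksr (V : finType) (Gamma : {set V * V}) (s r : nat) : nat :=
  \max_(E : {set V * V} | [&& simple_graph E, E \subset Gamma &
                              `[< ~ induced_sub (Kbip s r) E >]]) nedges E.

(* Main.v *)
Require Import Defs.
From HB Require Import structures.
From mathcomp Require Import all_boot all_order all_algebra all_field.
From mathcomp Require Import all_classical all_reals all_analysis.
From mathcomp Require Import Rstruct.
From mathcomp Require Import zify ring lra.
(* Imported again because [classical_sets] reuses their lemma names. *)
From mathcomp Require Import fintype finset.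
Set Implicit Arguments. Unset Strict Implicit. Unset Printing Implicit Defensive.
Import Order.TTheory GRing.Theory Num.Theory.
Local Open Scope ring_scope.

(** Let [#|F| = m ^ 2]. The subfield [k] of order [m] consists of squares, so the cosets of
    [k] are cliques of the Paley graph; [x |-> x ^+ m - x] has kernel [k] and labels the cosets.

    Lower bound: put a [K_{s,t}]-free norm graph on the [m] cosets, and keep the Paley edges
    inside cosets and between adjacent cosets. An independent set meets each coset at most
    once, so an induced [K_{s,r}] would project to a [K_{s,r-s}] in the norm graph. The norm
    graph lives on a field of order [2 ^ (k s)], the largest such power below [m]. Its
    [K_{s,t}]-freeness says that a system [prod_j (x_j - a_ij) = b_i] has boundedly many
    solutions, which holds because all monomials reduce modulo the system to boundedly many.

    Upper bound: counting pairs in the lines [x + w k] with [w] a nonsquare shows that a vertex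
    set of size at least [4 m] is far from being a clique, so its independent [s]-tuples have
    positive density. Double counting independent [s]-tuples in neighbourhoods yields one with
    so many common neighbours that they contain an independent [r]-tuple. *)

(** * Systems of products of linear factors *)

Section Span.
Variables (K : fieldType) (X : finType) (s : nat) (x : 'I_s -> X -> K).

Definition monomial (al : 'I_s -> nat) (p : X) : K := \prod_(j < s) x j p ^+ al j.

(* Membership of [g] in the linear span of the monomials with exponents in [P], stated as
   membership in the double annihilator; this keeps coefficients out of the arguments. *)
Definition mspan (P : ('I_s -> nat) -> Prop) (g : X -> K) : Prop :=
  forall lam : X -> K, (forall be, P be -> \sum_p lam p * monomial be p = 0) ->
    \sum_p lam p * g p = 0.

Definition below (u be : 'I_s -> nat) : Prop := forall j, (be j <= u j)%N.

Lemma monomialD al be p : monomial (fun j => al j + be j)%N p = monomial al p * monomial be p.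
Proof. rewrite /monomial; under eq_bigr do rewrite exprD; exact: big_split. Qed.

Lemma monomial0 p : monomial (fun=> 0%N) p = 1.
Proof. by rewrite /monomial big1. Qed.

Lemma monomial_single i e p : monomial (fun j => (j == i) * e)%N p = x i p ^+ e.
Proof.
rewrite /monomial (bigD1 i) //= eqxx mul1n big1 ?mulr1 // => j /negPf->.
by rewrite mul0n expr0.
Qed.

Lemma mspan_ext P g h : g =1 h -> mspan P g -> mspan P h.
Proof.
move=> gh Sg lam /Sg S0; rewrite -[RHS]S0.
by apply: eq_bigr => p _; rewrite gh.
Qed.

Lemma mspan_sub (P Q : ('I_s -> nat) -> Prop) g :
  (forall be, P be -> Q be) -> mspan P g -> mspan Q g.
Proof. by move=> PQ Sg lam kQ; apply: Sg => be /PQ/kQ. Qed.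

Lemma mspan_monomial (P : ('I_s -> nat) -> Prop) be : P be -> mspan P (monomial be).
Proof. by move=> Pbe lam; apply. Qed.

Lemma mspanD P g h : mspan P g -> mspan P h -> mspan P (fun p => g p + h p).
Proof.
move=> Sg Sh lam k; under eq_bigr do rewrite mulrDr.
by rewrite big_split /= Sg // Sh // addr0.
Qed.

Lemma mspanZ P c g : mspan P g -> mspan P (fun p => c * g p).
Proof.
move=> Sg lam k; under eq_bigr do rewrite mulrCA.
by rewrite -mulr_sumr Sg // mulr0.
Qed.

Lemma mspanC (P : ('I_s -> nat) -> Prop) c : P (fun=> 0%N) -> mspan P (fun=> c).
Proof.
move=> P0; apply: (@mspan_ext _ (fun p => c * monomial (fun=> 0%N) p)).
  by move=> p; rewrite monomial0 mulr1.
exact/mspanZ/mspan_monomial.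
Qed.

(** Weighting a functional by a function gives a functional: [lam] times [h] is tested against [g],
    then [lam] times a monomial against [h]. *)
Lemma mspanM (P Q R : ('I_s -> nat) -> Prop) g h :
  (forall be ga, P be -> Q ga -> R (fun j => be j + ga j)%N) ->
  mspan P g -> mspan Q h -> mspan R (fun p => g p * h p).
Proof.
move=> PQR Sg Sh lam kR; rewrite -[RHS](Sg (fun p => lam p * h p)).
  by apply: eq_bigr => p _; ring.
move=> be Pbe; rewrite -[RHS](Sh (fun p => lam p * monomial be p)).
  by apply: eq_bigr => p _; ring.
move=> ga Qga.
rewrite -[RHS](kR _ (PQR _ _ Pbe Qga)).
by apply: eq_bigr => p _; rewrite monomialD mulrA.
Qed.

Lemma mspan_XsubC j c : mspan (below (fun i => i == j)) (fun p => x j p - c).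
Proof.
apply: mspanD; last exact: mspanC.
apply: (@mspan_ext _ (monomial (fun i => (i == j) * 1)%N)).
  by move=> p; rewrite monomial_single expr1.
by apply: mspan_monomial => i; rewrite muln1.
Qed.

Arguments mspan_XsubC j c : clear implicits.

Lemma mspan_prod (I : Type) (r : seq I) (Q : pred I) (u : I -> 'I_s -> nat)
    (g : I -> X -> K) :
  (forall i, Q i -> mspan (below (u i)) (g i)) ->
  mspan (below (fun j => \sum_(i <- r | Q i) u i j)%N)
     (fun p => \prod_(i <- r | Q i) g i p).
Proof.
move=> Sg; elim: r => [|i r IH].
  by apply: (@mspan_ext _ (fun=> 1)) => [p|]; rewrite ?big_nil //; apply: mspanC.
have [Qi|nQi] := boolP (Q i); last first.
  apply: (@mspan_ext _ (fun p => \prod_(i <- r | Q i) g i p)).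
    by move=> p; rewrite big_cons (negPf nQi).
  by apply: mspan_sub IH => be le j; rewrite big_cons (negPf nQi).
apply: (@mspan_ext _ (fun p => g i p * \prod_(i <- r | Q i) g i p)).
  by move=> p; rewrite big_cons Qi.
apply: (mspanM _ (Sg i Qi) IH) => be ga le1 le2 j.
by rewrite big_cons Qi leq_add.
Qed.

(** * Functionals on the solution set of a system of product equations *)

Section System.
Variables (a : 'I_s -> 'I_s -> K) (b : 'I_s -> K).
Hypothesis a_inj : forall (i i' j : 'I_s), i != i' -> a i j != a i' j.
Hypothesis eqs : forall i p, \prod_(j < s) (x j p - a i j) = b i.

(* Rows outnumber columns and the entries of a column are distinct, so the products
   [prod_(j in T) (x_j - a_ij)], [i] in [R], have no common zero and generate the unit ideal. *)
Lemma functional_eq0 (T R : {set 'I_s}) lam : (#|T| < #|R|)%N ->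
  (forall i, i \in R -> forall be, below (fun j => (j \in T) * s)%N be ->
     \sum_p lam p * (monomial be p * \prod_(j in T) (x j p - a i j)) = 0) ->
  \sum_p lam p = 0.
Proof.
elim: {T}_.+1 {-2}T (ltnSn #|T|) R lam => // n IH T leTn R lam ltTR H.
have [T0|[m mT]] := set_0Vmem T.
  subst T.
  have /card_gt0P[i iR] : (0 < #|R|)%N by rewrite (leq_trans _ ltTR).
  rewrite -[RHS](H i iR (fun=> 0%N) _) //.
  by apply: eq_bigr => p _; rewrite monomial0 big_set0 !mulr1.
(* The induction hypothesis is applied to [lam] weighted by the product over [R :\ k], with column
   [m] and row [k] removed. For each remaining row [i] the weight supplies the missing factor
   [x m p - a i m]; the rest, [q], fits in the degree [s] allowed in column [m]. *)
have single k : k \in R -> \sum_p lam p * \prod_(i in R :\ k) (x m p - a i m) = 0.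
  move=> kR; have [cT cR] := (cardsD1 m T, cardsD1 k R).
  rewrite mT in cT; rewrite kR in cR.
  apply: (IH (T :\ m) _ (R :\ k)); [lia | lia |].
  move=> i; rewrite in_setD1 => /andP[ik iR] be leb.
  pose q p := \prod_(i' in R :\ k :\ i) (x m p - a i' m).
  have Sq : mspan (below (fun j => (j == m) * s)%N) q.
    apply: mspan_sub (@mspan_prod _ _ (mem (R :\ k :\ i)) (fun=> fun j => j == m) _ _).
      move=> ga leg j; apply: leq_trans (leg j) _.
      rewrite sum_nat_const mulnC leq_mul2l; apply/orP; right.
      by rewrite (leq_trans (max_card _)) // card_ord.
    by move=> i' _; apply: mspan_XsubC.
  rewrite -[RHS](Sq (fun p => lam p * (monomial be p * \prod_(j in T) (x j p - a i j)))).
    apply: eq_bigr => p _; rewrite [in RHS](big_setD1 m mT) /=.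
    rewrite (big_setD1 i) /= ?in_setD1 ?ik // -/(q p); ring.
  move=> ga leg; rewrite -[RHS](H i iR (fun j => be j + ga j)%N).
    by apply: eq_bigr => p _; rewrite monomialD; ring.
  move=> j; have := leb j; have := leg j; rewrite in_setD1.
  by case: eqP => [->|_]; rewrite ?mT /=; last case: (j \in T) => /=;
    rewrite ?mul1n ?mul0n; lia.
(* Two factors at distinct rows of [B] differ by a nonzero constant, so the products omitting
   [B :\ k] and [B :\ k'] combine to the one omitting [B]. Enlarging [B] to [R] leaves the empty
   product. *)
suff sub (B : {set 'I_s}) : B \subset R -> B != set0 ->
    \sum_p lam p * \prod_(i in R :\: B) (x m p - a i m) = 0.
  have R0 : R != set0 by rewrite -card_gt0 (leq_trans _ ltTR).
  have := sub R (subxx _) R0; rewrite setDv => E.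
  by rewrite -[RHS]E; apply: eq_bigr => p _; rewrite big_set0 mulr1.
elim: {B}_.+1 {-2}B (ltnSn #|B|) => // n' IHB B leB BR /set0Pn[k kB].
have [E|[k']] := set_0Vmem (B :\ k).
  by rewrite -(setD1K kB) E setU0; apply/single/(subsetP BR).
rewrite in_setD1 => /andP[k'k k'B].
have drop l : l \in B -> (exists2 l', l' \in B & l' != l) ->
    \sum_p lam p * ((x m p - a l m) * \prod_(i in R :\: B) (x m p - a i m)) = 0.
  move=> lB [l' l'B l'l].
  rewrite (cardsD1 l B) lB in leB; rewrite -[RHS](IHB (B :\ l)).
  - apply: eq_bigr => p _; congr (_ * _).
    rewrite (big_setD1 l (A := R :\: (B :\ l))) /=; last first.
      by rewrite !inE eqxx /= (subsetP BR).
    congr (_ * _); apply: eq_bigl => i; rewrite !inE.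
    by case: eqP => [->|_] //=; rewrite lB.
  - by [].
  - exact: subset_trans (subsetDl _ _) BR.
  - by apply/set0Pn; exists l'; rewrite in_setD1 l'l.
have nz : a k' m - a k m != 0 by rewrite subr_eq0 a_inj.
apply: (mulfI nz); rewrite mulr0 mulr_sumr.
have e1 : \sum_p lam p * ((x m p - a k m) * \prod_(i in R :\: B) (x m p - a i m)) = 0.
  by apply: drop => //; exists k'.
have e2 : \sum_p lam p * ((x m p - a k' m) * \prod_(i in R :\: B) (x m p - a i m)) = 0.
  by apply: drop => //; exists k; rewrite // eq_sym.
transitivity (\sum_p lam p * ((x m p - a k m) * \prod_(i in R :\: B) (x m p - a i m)) -
  \sum_p lam p * ((x m p - a k' m) * \prod_(i in R :\: B) (x m p - a i m))).
  by rewrite -sumrB; apply: eq_bigr => p _; ring.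
by rewrite e1 e2 subrr.
Qed.

(** The top monomials cancel, hence the drop in total degree. Peeling off one factor uses
    [x P - (x - c) P' = x (P - P') + c P']. *)
Lemma mspan_prod_diff (c : 'I_s -> K) (r : seq 'I_s) :
  mspan (fun ga => below (fun j => count_mem j r) ga /\ (\sum_j ga j < size r)%N)
     (fun p => \prod_(j <- r) x j p - \prod_(j <- r) (x j p - c j)).
Proof.
elim: r => [|j r IH].
  move=> lam _; rewrite big1 // => p _; by rewrite !big_nil subrr mulr0.
apply: (@mspan_ext _ (fun p => (x j p - 0) *
     (\prod_(j <- r) x j p - \prod_(j <- r) (x j p - c j)) +
   c j * \prod_(j <- r) (x j p - c j))).
  by move=> p; rewrite !big_cons; ring.
apply: mspanD.
  apply: (mspanM _ (mspan_XsubC j 0) IH) => be ga leb [leg ltg]; split.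
    by move=> i /=; rewrite [j == i]eq_sym leq_add.
  have : (\sum_i be i <= \sum_i (i == j))%N by apply: leq_sum => i _; apply: leb.
  have -> : (\sum_i (i == j) = 1)%N by rewrite (bigD1 j) //= eqxx big1 // => i /negPf->.
  move=> le1; rewrite big_split /=.
  by rewrite (leq_ltn_trans (leq_add le1 (leqnn _))) // add1n ltnS.
apply: mspanZ.
apply: (mspan_sub _ (@mspan_prod _ r predT (fun j i => i == j) (fun j p => x j p - c j) _)).
  have cnt i : (\sum_(k <- r) (i == k) = count_mem i r)%N.
    by rewrite -sum1_count [RHS]big_mkcond /=; apply: eq_bigr => k _; rewrite eq_sym; case: eqP.
  move=> be leb; split=> [i|] /=.
    by rewrite (leq_trans (leb i)) // cnt leq_addl.
  rewrite ltnS (leq_trans (leq_sum _ (fun i _ => leb i))) // exchange_big /=.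
  rewrite -sum1_size; apply: leq_sum => k _.
  by rewrite (bigD1 k) //= eqxx big1 // => i /negPf->.
by move=> i _; apply: mspan_XsubC.
Qed.


Arguments mspan_prod_diff c r : clear implicits.

(** By the equation of row [i], replacing the linear factors over [S] by the plain monomial changes
    [b i] only by terms of lower degree in [S]. Each of these misses a variable of [S], and so does
    the constant because [S] is nonempty. *)
Lemma mspan_mono_factor (S : {set 'I_s}) i : S != set0 ->
  mspan (fun ga => below (fun=> 1%N) ga /\ exists2 j, j \in S & ga j = 0%N)
     (fun p => \prod_(j in S) x j p * \prod_(j in ~: S) (x j p - a i j)).
Proof.
move=> S0.
apply: (@mspan_ext _ (fun p => (\prod_(j <- enum S) x j p
     - \prod_(j <- enum S) (x j p - a i j)) * \prod_(j in ~: S) (x j p - a i j)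
     + b i)) => [p|].
  have -> : b i = \prod_(j in S) (x j p - a i j) * \prod_(j in ~: S) (x j p - a i j).
    by rewrite -(eqs i p) (bigID (mem S)) /=; congr (_ * _); apply: eq_bigl => j; rewrite !inE.
  by rewrite !big_enum /=; ring.
have cnt j : count_mem j (enum S) = (j \in S).
  by rewrite count_uniq_mem ?enum_uniq // mem_enum.
apply: mspanD; last first.
  have [j jS] := set0Pn _ S0.
  by apply: mspanC; split => // ; exists j.
have span_prod := @mspan_prod _ (index_enum _) (mem (~: S)) (fun j k => k == j)
  (fun j p => x j p - a i j) (fun j _ => mspan_XsubC j (a i j)).
apply: (mspanM _ (mspan_prod_diff (a i) (enum S)) span_prod).
move=> be ga [leb ltb] leg.
have {}leg j : (ga j <= (j \notin S))%N.
  apply: leq_trans (leg j) _; rewrite big_mkcond (bigD1 j) //= eqxx inE big1.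
    by case: (j \in S).
  by move=> k /negPf; rewrite eq_sym => ->; case: ifP.
have {}leb j : (be j <= (j \in S))%N by rewrite -cnt.
split=> [j|]; first by have := leb j; have := leg j; case: (j \in S) => /=; lia.
have [/exists_inP[j jS /eqP E]|] := boolP [exists j in S, be j + ga j == 0]%N.
  by exists j.
rewrite negb_exists_in => /forall_inP H; move: ltb; rewrite ltnNge => /negP[].
rewrite -cardE -sum1_card big_mkcond; apply: leq_sum => j _.
case: ifP => // jS; have := H j jS; have := leg j; rewrite jS /=.
by case: (be j) => //; lia.
Qed.

Arguments mspan_mono_factor S i : clear implicits.

(* Induction on [Phi]. Some band of width [s + 1] contains no exponent of the given monomial;
   the exponents above it form [S]. By [functional_eq0], the monomial is a combination of its
   multiples by [prod_(j notin S) (x_j - a_ij)], and the equations lower an exponent in [S]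
   while raising those outside [S] by at most [s + 1], which the band allows. *)
Lemma functional_monomial_eq0 (lam : X -> K) :
  (forall be, below (fun=> s.+1 * s.+1)%N be -> \sum_p lam p * monomial be p = 0) ->
  forall al, \sum_p lam p * monomial al p = 0.
Proof.
move=> kill al; pose Phi (be : 'I_s -> nat) := (\sum_j s.+1 ^ be j)%N.
elim: {al}_.+1 {-2}al (ltnSn (Phi al)) => // n IH al leal.
have [/forallP|] := boolP [forall j, al j <= s.+1 * s.+1]%N; first exact: kill.
rewrite negb_forall => /existsP[j0]; rewrite -ltnNge => j0large.
have [t tgap] : exists t : 'I_s.+1, forall j, (al j %/ s.+1)%N != t.
  have [/existsP[t /forallP tP]|] :=
    boolP [exists t : 'I_s.+1, [forall j, (al j %/ s.+1)%N != t]]; first by exists t.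
  rewrite negb_exists => /forallP hit.
  have : (#|[set: 'I_s.+1]| <= #|[set (inord (al j %/ s.+1)%N : 'I_s.+1) | j in 'I_s]|)%N.
    apply: subset_leq_card; apply/subsetP => t _.
    have := hit t; rewrite negb_forall => /existsP[j]; rewrite negbK => /eqP E.
    by apply/imsetP; exists j => //; rewrite E inord_val.
  by move=> /leq_trans/(_ (leq_imset_card _ _)); rewrite cardsT !card_ord ltnn.
pose S := [set j | t < al j %/ s.+1]%N.
have inS j : j \in S -> (t.+1 * s.+1 <= al j)%N.
  by rewrite inE -leq_divRL.
have notinS j : j \notin S -> (al j < t * s.+1)%N.
  rewrite inE -leqNgt leq_eqVlt (negPf (tgap j)) /=.
  by rewrite -ltn_divLR.
(* The threshold [s.+1 * s.+1] lies above all [s.+1] bands, in particular above band [t]. *)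
have j0S : j0 \in S.
  rewrite inE leq_divRL //; apply: leq_trans (ltnW j0large).
  by rewrite leq_mul2r ltn_ord orbT.
have S0 : S != set0 by apply/set0Pn; exists j0.
pose al' j := (al j - (j \in S))%N.
have monS p : monomial al p = monomial al' p * \prod_(j in S) x j p.
  rewrite big_mkcond -big_split; apply: eq_bigr => j _ /=; rewrite /al'.
  case: ifP => jS; last by rewrite subn0 mulr1.
  by rewrite -exprSr subn1 prednK // (leq_trans _ (inS _ jS)).
apply: (@functional_eq0 (~: S) setT).
  rewrite cardsT card_ord -[X in (_ < X)%N](card_ord s) -(cardsC S).
  by rewrite -[X in (X < _)%N]add0n ltn_add2r card_gt0.
move=> i _ be leb.
have := mspan_mono_factor S i S0 (fun p => lam p * (monomial al' p * monomial be p)) => H.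
rewrite -[RHS]H; first by apply: eq_bigr => p _; rewrite monS; ring.
move=> ga [leg [j1 j1S ga0]].
rewrite -[RHS](IH (fun j => al' j + be j + ga j)%N).
  by apply: eq_bigr => p _; rewrite !monomialD; ring.
rewrite -ltnS (leq_trans _ leal) // ltnS.
rewrite /Phi (bigD1 j1) //= [X in (_ < X)%N](bigD1 j1) //=.
have a1 := inS _ j1S.
have E1 : (al' j1 + be j1 + ga j1 = (al j1).-1)%N.
  by have := leb j1; rewrite in_setC j1S /= ga0 /al' j1S; lia.
rewrite E1; set A := (s.+1 ^ (al j1).-1)%N.
have -> : (s.+1 ^ al j1 = s.+1 * A)%N by rewrite -expnS prednK //; lia.
(* Outside [S] the exponent was at most [t * s.+1 - 1] and grows by at most [s + 1], so it stays
   below [t.+1 * s.+1], hence at most [(al j1).-1]. *)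
have le j : (s.+1 ^ (al' j + be j + ga j) <= s.+1 ^ al j + A)%N.
  have [jS|jS] := boolP (j \in S).
    apply: leq_trans (leq_addr _ _); apply: leq_pexp2l => //.
    by have := leb j; have := leg j; have := inS _ jS; rewrite in_setC jS /= /al' jS; lia.
  apply: leq_trans (leq_addl _ _); apply: leq_pexp2l => //.
  have := leb j; have := leg j; have := notinS _ jS.
  by rewrite in_setC jS /= /al' (negPf jS); lia.
have : (\sum_(j | j != j1) s.+1 ^ (al' j + be j + ga j) <=
        \sum_(j | j != j1) s.+1 ^ al j + s.-1 * A)%N.
  apply: leq_trans (leq_sum _ (fun j _ => le j)) _.
  rewrite big_split /= leq_add2l sum_nat_const leq_mul2r; apply/orP; right.
  by rewrite -[X in (_ <= X.-1)%N]card_ord (cardC1 j1).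
have : (0 < A)%N by rewrite expn_gt0.
have s0 : (0 < s)%N := leq_ltn_trans (leq0n _) (ltn_ord j1).
have -> : (s.+1 * A = A + (A + s.-1 * A))%N by rewrite -{1}(prednK s0) !mulSn.
clearbody A; set U := (\sum_(j | _) _)%N; set V := (\sum_(j | _) _)%N.
by move: U V => U V; lia.
Qed.

(** With more solutions than monomials of exponents at most [s.+1 * s.+1], some nonzero functional
    kills these monomials, hence all monomials. It then kills the polynomial in [x j0] that vanishes
    at every solution but one from its support, which is absurd. *)
Lemma card_solutions (j0 : 'I_s) : injective (x j0) ->
  (#|X| <= (s.+1 * s.+1).+1 ^ s)%N.
Proof.
move=> xinj; rewrite leqNgt; apply/negP => big.
pose M := (s.+1 * s.+1)%N.
pose J := {ffun 'I_s -> 'I_M.+1}.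
pose A : 'M[K]_(#|X|, #|J|) :=
  \matrix_(p, f) monomial (fun j => (enum_val f : J) j) (enum_val p).
have cJ : #|J| = (M.+1 ^ s)%N by rewrite card_ffun !card_ord.
have : (0 < \rank (kermx A))%N.
  by rewrite mxrank_ker subn_gt0 (leq_ltn_trans (rank_leq_col _)) // cJ.
rewrite lt0n mxrank_eq0 => /rowV0Pn[v /sub_kermxP vA v0].
pose lam p := v 0 (enum_rank p).
have kill be : below (fun=> M) be -> \sum_p lam p * monomial be p = 0.
  move=> leb; pose f : J := [ffun j => inord (be j)].
  have /matrixP/(_ 0 (enum_rank f)) := vA; rewrite mxE => E.
  transitivity ((0 : 'rV[K]_#|J|) 0 (enum_rank f)); last by rewrite mxE.
  rewrite -E [RHS](reindex _ (onW_bij _ (@enum_rank_bij X))) /=.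
  apply: eq_bigr => p _; rewrite /lam mxE !enum_rankK; congr (_ * _).
  by apply: eq_bigr => j _; rewrite ffunE inordK // ltnS leb.
have killall := functional_monomial_eq0 kill.
have /existsP[p0 p0n] : [exists p, lam p != 0].
  apply: contraNT v0; rewrite negb_exists => /forallP v0.
  apply/eqP/rowP => i; rewrite mxE; apply/eqP.
  by have := v0 (enum_val i); rewrite negbK /lam enum_valK.
have Sfull : mspan (fun _ => True) (fun p => \prod_(p' | p' != p0) (x j0 p - x j0 p')).
  apply: mspan_sub (@mspan_prod _ (index_enum _) (fun p' => p' != p0) (fun _ k => k == j0)
    (fun p' p => x j0 p - x j0 p') (fun p' _ => mspan_XsubC j0 (x j0 p'))).
  by [].
have := Sfull lam (fun be _ => killall be).
have van p : p != p0 -> lam p * \prod_(p' | p' != p0) (x j0 p - x j0 p') = 0.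
  by move=> pp0; rewrite (bigD1 p) //= subrr mul0r mulr0.
rewrite (bigD1 p0) //= (big1 _ _ _ van) => /eqP; rewrite addr0 mulf_eq0 (negPf p0n) /=.
move=> /prodf_eq0[p pp0].
by rewrite subr_eq0 => /eqP/xinj E; rewrite E eqxx in pp0.
Qed.

End System.
End Span.

(** * Norm graphs *)

Lemma card_root_set (F : finFieldType) (p : {poly F}) (S : {set F}) :
  p != 0 -> (forall z, z \in S -> root p z) -> (#|S| < size p)%N.
Proof.
move=> p0 rS; rewrite cardE; apply: max_poly_roots => //; last exact: enum_uniq.
by apply/allP => z; rewrite mem_enum => /rS.
Qed.

Lemma card_expf_eq (F : finFieldType) n (c : F) : (0 < n)%N ->
  (#|[set z : F | z ^+ n == c]| <= n)%N.
Proof.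
move=> n0; rewrite -ltnS -(size_XnsubC c n0); apply: card_root_set.
  by rewrite -size_poly_gt0 size_XnsubC.
by move=> z; rewrite inE rootE !hornerE subr_eq0.
Qed.

Lemma card_expf_fix (F : finFieldType) n : (1 < n)%N ->
  (#|[set z : F | z ^+ n == z]| <= n)%N.
Proof.
move=> n1.
have sz : size ('X^n - 'X : {poly F}) = n.+1.
  by rewrite size_polyDl size_polyXn // size_polyN size_polyX ltnS.
rewrite -ltnS -sz; apply: card_root_set.
  by rewrite -size_poly_gt0 sz.
by move=> z; rewrite inE rootE !hornerE subr_eq0.
Qed.

Lemma pigeonhole_fiber (A B : finType) (f : A -> B) (S : {set A}) (V : {set B}) n :
  (forall x, x \in S -> f x \in V) -> (#|V| * n < #|S|)%N ->
  exists b, (n < #|[set x in S | f x == b]|)%N.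
Proof.
move=> fS big; apply/existsP; apply: contraLR big; rewrite negb_exists => /forallP H.
rewrite -leqNgt -sum1_card (partition_big f (mem V)) //=.
rewrite -sum_nat_const; apply: leq_sum => b _; rewrite sum1dep_card.
by rewrite leqNgt; exact: H.
Qed.

Section NormGraph.
Variables (L : finFieldType) (k s : nat).
Hypotheses (k0 : (0 < k)%N) (s0 : (0 < s)%N) (cardL : #|L| = (2 ^ (k * s))%N).
Let N := (2 ^ k)%N.

(** The norm from the field of order [N ^ s] to its subfield of order [N], as the product of the
    conjugates. *)
Definition fnorm (z : L) : L := \prod_(j < s) z ^+ (N ^ j).

Let charL : 2%N \in [pchar L].
Proof. exact: card_finPcharP cardL _. Qed.

Let N_gt1 : (1 < N)%N.
Proof. by rewrite -(exp1n k) ltn_exp2r. Qed.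

Let cardLN : #|L| = (N ^ s)%N.
Proof. by rewrite cardL expnM. Qed.

Lemma frobN j (u v : L) : (u + v) ^+ (N ^ j) = u ^+ (N ^ j) + v ^+ (N ^ j).
Proof.
apply: exprDn_pchar; rewrite -expnM pnatX; apply/orP; left.
by rewrite pnatE.
Qed.

Lemma frobN_inj j : injective (fun z : L => z ^+ (N ^ j)).
Proof.
move=> u v /= E; apply/eqP; rewrite -subr_eq0.
have : (u - v) ^+ (N ^ j) = 0.
  by apply: (addIr (v ^+ (N ^ j))); rewrite -frobN subrK add0r.
by move/eqP; rewrite expf_eq0 => /andP[].
Qed.

(** The [N]-th power shifts the conjugates cyclically, since [z ^+ (N ^ s) = z]. *)
Lemma fnorm_fix z : fnorm z ^+ N = fnorm z.
Proof.
have [->|z0] := eqVneq z 0.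
  rewrite /fnorm (bigD1 (Ordinal s0)) //= expr1 mul0r expr0n.
  by case: N N_gt1.
apply: (mulIf z0); rewrite {1}/fnorm -prodrXl.
rewrite (eq_bigr (fun j : 'I_s => z ^+ (N ^ j.+1))); last first.
  by move=> j _; rewrite -exprM -expnSr.
transitivity (\prod_(0 <= j < s.+1) z ^+ (N ^ j)).
  by rewrite big_nat_recl // big_mkord mulrC expn0 expr1.
by rewrite big_nat_recr //= big_mkord -cardLN expf_card.
Qed.

Lemma fnorm_fiber : exists2 b, b != 0 & (N ^ s.-1 <= #|[set z | fnorm z == b]|)%N.
Proof.
(* Only the nonzero elements are distributed, which keeps [b] nonzero; this still suffices because
   [N * (N ^ s.-1 - 1) < N ^ s - 1]. *)
have [||b] := @pigeonhole_fiber _ _ fnorm [set~ 0] [set z : L | z ^+ N == z] (N ^ s.-1).-1.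
- by move=> z _; rewrite inE fnorm_fix.
- rewrite cardsC1 cardLN; apply: leq_ltn_trans (leq_mul (card_expf_fix L N_gt1) (leqnn _)) _.
  have : (0 < N ^ s.-1)%N by rewrite expn_gt0 ltnW.
  have -> : (N ^ s = N * N ^ s.-1)%N by rewrite -expnS prednK.
  case: (N ^ s.-1)%N => // M _; rewrite mulnS; have := N_gt1.
  by set NM := (N * M)%N; lia.
rewrite prednK ?expn_gt0 ?(ltnW N_gt1) // => leb; exists b.
  apply: contraTneq leb => ->; rewrite -ltnNge.
  rewrite (_ : [set x in _ | _] = set0) ?cards0 ?expn_gt0 ?(ltnW N_gt1) //.
  apply/setP => z; rewrite !inE; apply/negP => /andP[z0 /prodf_eq0[j _]].
  by rewrite expf_eq0 (negPf z0) andbF.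
by apply: leq_trans leb _; apply/subset_leq_card/subsetP => z; rewrite !inE => /andP[].
Qed.

End NormGraph.

(** Adjacency means that [x + y] has norm [b]. Conjugation is additive, so a common neighbour [z] of
    the [y i] solves the system with unknowns the conjugates of [z] and [a i j] minus the conjugates
    of [y i]. There are no loops since [x + x = 0] in characteristic two and [b] is nonzero. *)
Lemma norm_graph (s : nat) : (0 < s)%N ->
  exists D : nat, forall k, (0 < k)%N -> exists (L : finFieldType) (e : rel L),
  [/\ #|L| = (2 ^ (k * s))%N, symmetric e, irreflexive e,
   (2 ^ (k * s) * 2 ^ (k * s.-1) <= #|[set p : L * L | e p.1 p.2]|)%N &
   forall y : 'I_s -> L, injective y -> (#|[set z | [forall i, e z (y i)]]| <= D)%N].
Proof.
move=> s0; exists ((s.+1 * s.+1).+1 ^ s)%N => k k0.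
have ks0 : (0 < k * s)%N by rewrite muln_gt0 k0.
have [L charL cardL] := @pPrimePowerField 2 _ isT ks0.
have [b b0 leb] := fnorm_fiber k0 s0 cardL.
exists L, (fun x y => fnorm k s (x + y) == b); split => //.
- by move=> x y; rewrite addrC.
- move=> x; rewrite (addrr_pchar2 charL).
  apply/negP => /eqP E; move: b0; rewrite -E /fnorm.
  by rewrite (bigD1 (Ordinal s0)) //= expr1 mul0r eqxx.
- rewrite -sum1_card.
  rewrite (eq_bigl (fun p : L * L => predT p.1 && (fnorm k s (p.1 + p.2) == b))); last first.
    by move=> p; rewrite inE.
  rewrite -(pair_big_dep predT (fun x y => fnorm k s (x + y) == b) (fun _ _ => 1%N)) /=.
  rewrite -cardL -sum_nat_const; apply: leq_sum => x _.
  rewrite expnM (leq_trans leb) // sum1dep_card.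
  rewrite -(card_imset _ (addrI (- x))); apply/subset_leq_card/subsetP => _ /imsetP[z zb ->].
  by rewrite inE in zb; rewrite inE addrA subrr add0r.
move=> y yinj; set S := [set z | _].
pose X := {z : L | z \in S}.
have -> : #|S| = #|{: X}| by rewrite card_sig.
pose x (j : 'I_s) (p : X) : L := val p ^+ ((2 ^ k) ^ j).
pose a (i j : 'I_s) : L := - (y i ^+ ((2 ^ k) ^ j)).
apply: (@card_solutions L X s x a (fun=> b) _ _ (Ordinal s0)).
- move=> i i' j; apply: contraNneq => /oppr_inj E; apply/eqP/yinj.
  exact: (frobN_inj cardL) E.
- move=> i p; have /[!inE]/forallP/(_ i)/eqP <- := valP p.
  by apply: eq_bigr => j _; rewrite /x /a opprK (frobN cardL).
- by move=> p p' /=; rewrite /x /= !expr1 => /val_inj.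
Qed.

(** * Squares and cosets in a field of square order *)

Lemma card_fibers (A B : finType) (f : A -> B) (S : {set A}) :
  #|S| = (\sum_(b in f @: S) #|[set x in S | f x == b]|)%N.
Proof.
rewrite -sum1_card (partition_big f (mem (f @: S))) /=.
  by apply: eq_bigr => b _; rewrite sum1dep_card.
by move=> x xS; apply: imset_f.
Qed.

(** Cauchy-Schwarz for the fibre sizes [n b], whose squares count the colliding pairs. *)
Lemma collisions (A B : finType) (f : A -> B) (T : {set A}) (V : {set B}) :
  (forall x, f x \in V) ->
  (#|T| ^ 2 <= #|V| * \sum_(x in T) \sum_(y in T) (f x == f y))%N.
Proof.
move=> fV; pose n b := (\sum_(x in T) (f x == b))%N.
have sT : #|T| = (\sum_(b in V) n b)%N.
  rewrite exchange_big /= -sum1_card; apply: eq_bigr => x _.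
  by rewrite (bigD1 (f x)) //= eqxx big1 // => b /andP[_]; rewrite eq_sym => /negPf->.
have -> : (\sum_(x in T) \sum_(y in T) (f x == f y) = \sum_(b in V) n b ^ 2)%N.
  under [RHS]eq_bigr => b _ do rewrite expnS expn1 big_distrl /=.
  rewrite [RHS]exchange_big /=; apply: eq_bigr => x _.
  rewrite (bigD1 (f x)) //= eqxx mul1n [X in (_ + X)%N]big1 ?addn0.
    by apply: eq_bigr => y _; rewrite eq_sym.
  by move=> b /andP[_]; rewrite eq_sym => /negPf->.
rewrite -(leq_pmul2l (isT : 0 < 2)%N) sT expnS expn1 big_distrl big_distrr /=.
under eq_bigr => b _ do rewrite !big_distrr /=.
apply: leq_trans (leq_sum _ (fun b _ => leq_sum _ (fun c _ => nat_Cauchy (n b) (n c)))) _.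
under eq_bigr => b _ do rewrite big_split /= sum_nat_const.
by rewrite big_split /= -big_distrr sum_nat_const mul2n addnn.
Qed.

Section SquareOrder.
Variables (F : finFieldType) (m : nat).
Hypotheses (cardF : #|F| = (m ^ 2)%N) (oddm : odd m).

(** Zero counts as a square here, so Paley adjacency also asks for distinctness. *)
Definition issq (z : F) := [exists w : F, w ^+ 2 == z].
Definition lab (x : F) := x ^+ m - x.
Definition subk : {set F} := [set x | x ^+ m == x].
Definition labs : {set F} := lab @: [set: F].

Lemma sqrt_card_gt2 : (2 < m)%N.
Proof.
have := finNzRing_gt1 F; rewrite cardF.
by case: m oddm => [|[|[|]]].
Qed.

Let m_gt0 : (0 < m)%N. Proof. by apply: leq_trans sqrt_card_gt2. Qed.

(** Makes [x ^+ m] additive in [x]. *)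
Lemma sqrt_card_pnat : [pchar F].-nat m.
Proof.
have [p pr_p pF] := finPcharP F.
have := abelian.abelem_pgroup (abelian.fin_ring_pchar_abelem pF).
rewrite /pgroup.pgroup cardsT cardF pnatX orbF => pm.
by rewrite (eq_pnat _ (pcharf_eq pF)).
Qed.

Lemma labD x y : lab (x + y) = lab x + lab y.
Proof. by rewrite /lab (exprDn_pchar _ _ sqrt_card_pnat); ring. Qed.

Lemma labN x : lab (- x) = - lab x.
Proof.
apply: (addrI (lab x)); rewrite -labD !subrr.
by rewrite /lab subr0 expr0n eqn0Ngt m_gt0.
Qed.

Lemma labB x y : lab (x - y) = lab x - lab y.
Proof. by rewrite labD labN. Qed.

Lemma subkE x : (x \in subk) = (lab x == 0).
Proof. by rewrite inE subr_eq0. Qed.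

Lemma labZ a x : a \in subk -> lab (a * x) = a * lab x.
Proof. by rewrite inE => /eqP ak; rewrite /lab exprMn ak mulrBr. Qed.

Lemma expf_sqrt_card2 (x : F) : (x ^+ m) ^+ m = x.
Proof. by rewrite -exprM -[(m * m)%N]/(m ^ 2)%N -cardF expf_card. Qed.

Lemma lab_expm x : lab x ^+ m = - lab x.
Proof.
have := labD (x ^+ m) (- x); rewrite labN {1}/lab.
rewrite -[x ^+ m - x]/(lab x) => /eqP; rewrite subr_eq => /eqP->.
by rewrite /lab expf_sqrt_card2; ring.
Qed.

(** The power [m.+1] maps the nonzero elements into the nonzero part of [subk] with fibres of size
    at most [m.+1], so its image has at least [m.-1] elements. As [subk] consists of roots of a
    polynomial of degree [m], both counts are sharp. *)
Lemma subk_units :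
  subk :\ 0 = [set z ^+ m.+1 | z in [set~ (0 : F)]] /\ #|subk| = m.
Proof.
set V := imset _ _.
have k0 : 0 \in subk by rewrite inE expr0n eqn0Ngt m_gt0.
have km : (#|subk| <= m)%N by apply: card_expf_fix; apply: leq_trans sqrt_card_gt2.
have sVk : V \subset subk :\ 0.
  apply/subsetP => _ /imsetP[z /[!inE] z0 ->].
  by rewrite expf_eq0 (negPf z0) andbF -exprM mulSn exprD exprM expf_sqrt_card2 -exprSr eqxx.
have cV : (m.-1 <= #|V|)%N.
  have : (#|[set~ (0%R : F)]| <= #|V| * m.+1)%N.
    rewrite (card_fibers (fun z => z ^+ m.+1) [set~ 0]) -/V.
    apply: (@leq_trans (\sum_(b in V) m.+1)%N); last by rewrite sum_nat_const.
    apply: leq_sum => b _; apply: leq_trans (card_expf_eq b (ltn0Sn m)).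
    by apply/subset_leq_card/subsetP => z; rewrite !inE => /andP[].
  rewrite cardsC1 cardF; case: m m_gt0 => // n _ /=.
  by move=> H; rewrite leqNgt; apply/negP; nia.
have := cardsD1 0 subk; rewrite k0 => ck.
have ckV := subset_leq_card sVk.
have e1 : #|subk| = m.
  by apply/eqP; rewrite eqn_leq km ck add1n -{1}(prednK m_gt0) ltnS (leq_trans cV ckV).
split=> //; apply/esym/eqP; rewrite eqEcard sVk /= (leq_trans _ cV) //.
by rewrite -ltnS -add1n -ck e1 prednK.
Qed.

Lemma card_subk : #|subk| = m. Proof. exact: (proj2 subk_units). Qed.

(** Nonzero elements of [subk] are [m.+1]-th powers, and [m.+1] is even. *)
Lemma issq_subk a : a \in subk -> issq a.
Proof.
have [->|a0 ak] := eqVneq a 0; first by move=> _; apply/existsP; exists 0; rewrite expr0n.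
have : a \in subk :\ 0 by rewrite in_setD1 a0.
rewrite (proj1 subk_units) => /imsetP[z _ ->].
apply/existsP; exists (z ^+ m.+1./2); rewrite -exprM muln2.
by rewrite -[X in _ == z ^+ X](odd_double_half m.+1) /= oddm.
Qed.

Lemma issqM a z : issq a -> a != 0 -> issq (a * z) = issq z.
Proof.
move=> /existsP[w /eqP wa] a0; apply/existsP/existsP => [[u /eqP uz]|[u /eqP uz]].
  by exists (u / w); rewrite expr_div_n uz wa mulrAC mulfV // mul1r.
by exists (w * u); rewrite exprMn wa uz.
Qed.

Lemma issqN z : issq (- z) = issq z.
Proof.
rewrite -mulN1r issqM ?oppr_eq0 ?oner_eq0 //.
by apply: issq_subk; rewrite subkE labN /lab expr1n subrr oppr0.
Qed.

Lemma two_neq0 : (2%:R : F) != 0.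
Proof.
apply/negP => c2; have c : 2%N \in [pchar F] by rewrite inE.
have := sqrt_card_pnat; rewrite (eq_pnat _ (pcharf_eq c)) => /p_natP[[|n] mE].
  by have := sqrt_card_gt2; rewrite mE.
by move: oddm; rewrite mE oddX.
Qed.

(** * Number of squares and their distribution over the cosets *)

Definition sqs : {set F} := [set z | issq z].

Lemma card_sqs : (#|sqs|.*2 = m ^ 2 + 1)%N.
Proof.
have z0 : 0 \in sqs by rewrite inE; apply/existsP; exists 0; rewrite expr0n.
have E : sqs :\ 0 = [set z ^+ 2 | z in [set~ (0 : F)]].
  apply/setP => z; rewrite !inE; apply/andP/imsetP => [[zn /existsP[w /eqP wz]]|[w]].
    by exists w => //; rewrite !inE; apply: contraNneq zn => w0; rewrite -wz w0 expr0n.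
  rewrite !inE => w0 ->; split; first by rewrite expf_eq0.
  by apply/existsP; exists w.
have : (m ^ 2).-1 = (#|sqs :\ 0%R| * 2)%N.
  rewrite -cardF -(cardsC1 (0 : F)) (card_fibers (fun z => z ^+ 2) [set~ 0]) -E.
  rewrite -sum_nat_const; apply: eq_bigr => b; rewrite E => /imsetP[w].
  rewrite !inE => w0 ->.
  have -> : [set x in [set~ 0] | x ^+ 2 == w ^+ 2] = [set w; - w].
    apply/setP => x; rewrite !inE eqf_sqr; apply/andP/idP => [[]//|H]; split=> //.
    by case/orP: H => /eqP->; rewrite ?oppr_eq0.
  rewrite cards2; case: eqP => // ww; case/negP: w0.
  have : 2%:R * w = 0 by rewrite mulr2n mulrDl mul1r {1}ww addNr.
  by move/eqP; rewrite mulf_eq0 (negPf two_neq0).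
have m2 : (0 < m ^ 2)%N by rewrite expn_gt0 m_gt0.
move=> E2; rewrite (cardsD1 0 sqs) z0 doubleD -[X in (_ + X)%N]muln2 -E2.
by rewrite addSn add1n prednK // addn1.
Qed.

Lemma card_labs_mul : (#|labs| * m = m ^ 2)%N.
Proof.
rewrite -cardF -cardsT (card_fibers lab setT) -/labs -sum_nat_const.
apply: eq_bigr => _ /imsetP[w _ ->]; rewrite -{1}card_subk.
rewrite -(card_imset _ (addrI w)); apply: eq_card => x; rewrite inE in_setT /=.
apply/imsetP/eqP => [[z zk ->]|xw].
  by rewrite labD; move: zk; rewrite subkE => /eqP->; rewrite addr0.
by exists (x - w); [rewrite subkE labB xw subrr | rewrite addrC subrK].
Qed.

Lemma card_labs : #|labs| = m.
Proof. by apply/eqP; rewrite -(eqn_pmul2r m_gt0) card_labs_mul. Qed.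

Lemma card_lab_fiber b : b \in labs -> #|[set x | lab x == b]| = m.
Proof.
move=> /imsetP[w _ ->]; rewrite -[RHS]card_subk -(card_imset subk (addrI w)).
apply: eq_card => x; rewrite inE.
apply/eqP/imsetP => [xw|[z zk ->]].
  by exists (x - w); [rewrite subkE labB xw subrr | rewrite addrC subrK].
by rewrite labD; move: zk; rewrite subkE => /eqP->; rewrite addr0.
Qed.

Lemma lab_in x : lab x \in labs.
Proof. by apply: imset_f; rewrite inE. Qed.

Lemma labs_sub b c : b \in labs -> c \in labs -> b - c \in labs.
Proof. by move=> /imsetP[x _ ->] /imsetP[y _ ->]; rewrite -labB lab_in. Qed.

Definition sqfib (b : F) : {set F} := [set z | issq z & lab z == b].

(* Nonzero labels [z] satisfy [z ^+ m = - z], hence differ by factors from the subfield. *)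
Lemma sqfib_le b c : b \in labs -> c \in labs -> b != 0 -> c != 0 ->
  (#|sqfib b| <= #|sqfib c|)%N.
Proof.
move=> bl cl b0 c0; pose a := c / b.
have a0 : a != 0 by rewrite mulf_neq0 ?invr_eq0.
have ak : a \in subk.
  have E d : d \in labs -> d ^+ m = - d by case/imsetP => x _ ->; rewrite lab_expm.
  by rewrite inE expr_div_n !E // invrN mulrNN.
rewrite -(card_imset _ (mulfI a0)); apply/subset_leq_card/subsetP => y /imsetP[z].
rewrite !inE => /andP[sz /eqP zb] ->; rewrite (issqM _ (issq_subk ak) a0) sz /=.
by rewrite labZ // zb /a divfK.
Qed.

(** [subk] holds [m] of the squares; the other [m.-1] cosets share the remaining [(m - 1) ^ 2 / 2]
    equally. *)
Lemma card_sqfib b : b \in labs -> b != 0 -> (m.-1 <= #|sqfib b|.*2)%N.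
Proof.
move=> bl b0.
have E : (#|sqs :\: subk| <= m.-1 * #|sqfib b|)%N.
  have -> : m.-1 = #|labs :\ 0|.
    have l0 : 0 \in labs by rewrite -(subrr (lab 0)) -labB lab_in.
    by transitivity #|labs|.-1; [rewrite card_labs | rewrite (cardsD1 0) l0].
  rewrite (card_fibers lab (sqs :\: subk)) -sum_nat_const.
  apply: (@leq_trans (\sum_(c in lab @: (sqs :\: subk)) #|sqfib b|)%N).
    apply: leq_sum => _ /imsetP[x xs ->].
    apply: (@leq_trans #|sqfib (lab x)|).
      by apply/subset_leq_card/subsetP => y; rewrite !inE -andbA => /and3P[_ -> ->].
    apply: sqfib_le => //; first exact: lab_in.
    by move: xs; rewrite in_setD subkE => /andP[].
  rewrite !sum_nat_const leq_mul2r; apply/orP; right.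
  apply/subset_leq_card/subsetP => _ /imsetP[x xs ->].
  rewrite in_setD1 lab_in andbT.
  by move: xs; rewrite in_setD subkE => /andP[].
have : #|sqs :\: subk| = (#|sqs| - m)%N.
  rewrite cardsD -card_subk; congr (_ - #|pred_of_set _|)%N.
  by apply/setIidPr/subsetP => x /issq_subk; rewrite inE.
move: E card_sqs sqrt_card_gt2; rewrite -!mul2n; case: (m) => // n; rewrite /= => E E1 n1 E2.
move: E1; rewrite -[(n.+1 ^ 2)%N]/(n.+1 * n.+1)%N => E1; nia.
Qed.

End SquareOrder.

(** * Independent tuples *)

Lemma leq_expW a b k : (a <= b -> a ^ k <= b ^ k)%N.
Proof. by case: k => // k; rewrite leq_exp2r. Qed.

Section IndependentTuples.
Variables (F : finFieldType) (m : nat).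
Hypotheses (cardF : #|F| = (m ^ 2)%N) (oddm : odd m).

(** Implies [x != y], since zero is a square; independent tuples thus have distinct entries. *)
Definition nadj (x y : F) := ~~ issq (x - y).

Let m_gt2 := sqrt_card_gt2 cardF oddm.

(** For each nonsquare [w], the [m] lines of direction [w] carry at least [#|T| ^ 2 / m] pairs of
    [T]. A pair of distinct points lies on such a line only if its difference is a nonsquare, and
    then for at most [m] choices of [w]. *)
Lemma nadj_dense (T : {set F}) : (4 * m <= #|T|)%N ->
  (#|T| ^ 2 <= 4 * \sum_(x in T) \sum_(y in T) nadj x y)%N.
Proof.
move=> bigT; pose n := #|[set w : F | ~~ issq w]|.
set NA := (\sum_(x in T) _)%N.
have nE : (n.*2 = m ^ 2 - 1)%N.
  rewrite -mul2n; have := card_sqs cardF oddm; rewrite -mul2n.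
  have := cardsC (sqs F); rewrite cardF (_ : ~: sqs F = [set w | ~~ issq w]); last first.
    by apply/setP => w; rewrite !inE.
  by rewrite -/n; move: #|_| n => a b; lia.
have line w : ~~ issq w -> (#|T| ^ 2 <=
    m * \sum_(x in T) \sum_(y in T) ((x - y) / w \in subk F m))%N.
  move=> nw; rewrite -[X in (_ <= X * _)%N](card_labs cardF oddm).
  have H := @collisions _ _ (fun x => lab m (x / w)) T (labs F m) (fun x => lab_in m (x / w)).
  apply: leq_trans H _; rewrite leq_mul2l; apply/orP; right.
  apply: leq_sum => x _; apply: leq_sum => y _.
  by rewrite subkE mulrBl (labB cardF oddm) subr_eq0.
have total : (n * #|T| ^ 2 <= m * \sum_(x in T) \sum_(y in T)
    \sum_(w | ~~ issq w) ((x - y) / w \in subk F m))%N.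
  rewrite (_ : (\sum_(x in T) _ = \sum_(w : F | ~~ issq w)
     \sum_(x in T) \sum_(y in T) ((x - y) / w \in subk F m))%N); last first.
    by rewrite [RHS]exchange_big /=; apply: eq_bigr => x _; rewrite exchange_big.
  rewrite /n -sum1dep_card big_distrl big_distrr /=.
  by apply: leq_sum => w nw; rewrite mul1n line.
have pair x y : (\sum_(w | ~~ issq w) ((x - y) / w \in subk F m) <=
    (x == y) * n + nadj x y * m)%N.
  have [->|xy] := eqVneq x y.
    rewrite mul1n (leq_trans _ (leq_addr _ _)) // /n -sum1dep_card.
    by apply: leq_sum => w _; apply: leq_b1.
  rewrite add0n /nadj; have d0 : x - y != 0 by rewrite subr_eq0.
  have notk w : ~~ issq w -> (x - y) / w \in subk F m -> ~~ issq (x - y).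
    move=> nw wk; have w0 : w != 0.
      apply: contraNneq nw => ->; apply: (issq_subk cardF oddm).
      by rewrite inE expr0n gtn_eqF // (leq_trans _ m_gt2).
    rewrite -(divfK w0 (x - y)) (issqM _ (issq_subk cardF oddm wk)) //.
    by rewrite mulf_neq0 ?invr_eq0.
  have [sq|nsq] := boolP (issq (x - y)); last first.
    rewrite mul1n -[X in (_ <= X)%N](card_subk cardF oddm).
    rewrite -big_mkcondr sum1dep_card.
    have inj : injective (fun w => (x - y) / w) by move=> u v /(mulfI d0)/invr_inj.
    rewrite -(card_imset _ inj); apply/subset_leq_card/subsetP => z /imsetP[w].
    by rewrite !inE => /andP[_ wk] ->.
  rewrite big1 // => w nw; case: (boolP (_ \in _)) => // wk.
  by have := notk w nw wk; rewrite sq.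
have fin : (n * #|T| ^ 2 <= m * (#|T| * n + NA * m))%N.
  apply: leq_trans total _; rewrite leq_mul2l; apply/orP; right.
  apply: leq_trans (leq_sum _ (fun x _ => leq_sum _ (fun y _ => pair x y))) _.
  under eq_bigr => x _ do rewrite big_split /=.
  rewrite big_split /= leq_add //.
    rewrite -sum_nat_const; apply: leq_sum => x xT.
    by rewrite (bigD1 x) //= eqxx mul1n big1 ?addn0 // => y /andP[_]; rewrite eq_sym => /negPf->.
  rewrite /NA big_distrl; apply: eq_leq; apply: eq_bigr => x _.
  by rewrite big_distrl.
clearbody NA n; move: nE fin bigT m_gt2; rewrite -mul2n.
rewrite -[(m ^ 2)%N]/(m * m)%N -[(#|T| ^ 2)%N]/(#|T| * #|T|)%N.
move: #|T| => t nE fin bigT m3.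
have n0 : (1 <= n)%N by nia.
(* As [4 * m <= t], the diagonal pairs take at most a quarter of the count; the other three quarters
   suffice because [m * m <= 3 * n]. *)
have e1 : (4 * (m * (t * n)) <= n * (t * t))%N by nia.
have e2 : (3 * (n * (t * t)) <= 4 * (m * m) * NA)%N by nia.
have e3 : (m * m <= 3 * n)%N by lia.
rewrite -(leq_pmul2l (isT : 0 < 3)%N) -(leq_pmul2l n0).
nia.
Qed.

Definition indep k (U : {set F}) : {set k.-tuple F} :=
  [set t : k.-tuple F | all (mem U) t && pairwise nadj t].

Lemma card_tupleS k (P : pred (k.+1.-tuple F)) :
  #|[set t | P t]| = (\sum_(x : F) #|[set t : k.-tuple F | P [tuple of x :: t]]|)%N.
Proof.
pose h (p : F * k.-tuple F) : k.+1.-tuple F := [tuple of p.1 :: p.2].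
have hb : bijective h.
  exists (fun t => (thead t, [tuple of behead t])) => [[x t]|t] /=.
    by congr (_, _); apply: val_inj.
  by rewrite /h /= -tuple_eta.
rewrite -sum1dep_card (reindex h (onW_bij _ hb)) /=.
rewrite (eq_bigl (fun p : F * k.-tuple F => predT p.1 && P [tuple of p.1 :: p.2])) //.
rewrite -(pair_big_dep predT (fun x (t : k.-tuple F) => P [tuple of x :: t]) (fun _ _ => 1%N)) /=.
by apply: eq_bigr => x _; rewrite sum1dep_card.
Qed.

Lemma indepS k U :
  #|indep k.+1 U| = (\sum_(x in U) #|indep k [set y in U | nadj x y]|)%N.
Proof.
rewrite card_tupleS [RHS]big_mkcond; apply: eq_bigr => x _.
have [xU|/negPf xU] := boolP (x \in U); last first.
  by apply: eq_card0 => t; rewrite inE /= xU.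
apply: eq_card => t; rewrite !inE /= xU /=.
rewrite andbA -all_predI; congr (_ && _); apply: eq_all => y /=.
by rewrite !inE.
Qed.

(** By density, at least an eighth of [U] has non-neighbourhoods filling at least an eighth of [U].
    Each such vertex can start a tuple continued inside its non-neighbourhood, at the cost of a
    factor [8] in size. *)
Lemma indep_many k (U : {set F}) : (4 * 8 ^ k * m <= #|U|)%N ->
  (#|U| ^ k <= 8 ^ (k * k) * #|indep k U|)%N.
Proof.
elim: k U => [|k IH] U bigU.
  by rewrite expn0 mul1n; apply/card_gt0P; exists [tuple]; rewrite inE.
have U4 : (4 * m <= #|U|)%N.
  by apply: leq_trans bigU; rewrite leq_mul2r leq_pmulr ?orbT // expn_gt0.
pose nb x := #|[set y in U | nadj x y]|.
have nbE x : (\sum_(y in U) nadj x y = nb x)%N.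
  by rewrite /nb -sum1dep_card [RHS]big_mkcondr.
pose U1 := [set x in U | #|U| <= 8 * nb x]%N.
have U1P : (#|U| <= 8 * #|U1|)%N.
  have U0 : (0 < #|U|)%N by apply: leq_trans U4; have := m_gt2; lia.
  have := nadj_dense U4; under eq_bigr => x _ do rewrite nbE.
  have : (8 * \sum_(x in U) nb x <= 8 * (#|U1| * #|U|) + #|U| * #|U|)%N.
    rewrite (bigID (mem U1)) /= mulnDr leq_add //.
      rewrite leq_mul2l /= -sum_nat_const.
      rewrite [X in (X <= _)%N](eq_bigl (mem U1)); last by move=> x; rewrite !inE; case: (x \in U).
      apply: leq_sum => x _; apply/subset_leq_card/subsetP => y.
      by rewrite inE => /andP[].
    rewrite big_distrr /= -sum_nat_const [X in (_ <= X)%N](bigID (mem U1)) /=.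
    apply: leq_trans (leq_addl _ _).
    apply: leq_sum => x /andP[xU]; rewrite inE xU /= -ltnNge; exact: ltnW.
  rewrite -[(#|U| ^ 2)%N]/(#|U| * #|U|)%N; move: (\sum_(_ in _) _)%N U0 => Z.
  move: #|U| #|U1| => u u1 u0 H1 H2.
  by rewrite -(leq_pmul2r u0); nia.
have step : (#|U1| * #|U| ^ k <= 8 ^ k * 8 ^ (k * k) * #|indep k.+1 U|)%N.
  rewrite indepS big_distrr /= -sum_nat_const.
  rewrite [X in (_ <= X)%N](bigID (mem U1)) /=; apply: leq_trans (leq_addr _ _).
  rewrite [X in (_ <= X)%N](eq_bigl (mem U1)); last by move=> x; rewrite !inE; case: (x \in U).
  apply: leq_sum => x; rewrite inE => /andP[xU large].
  have := IH [set y in U | nadj x y]; rewrite -/(nb x) => IHx.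
  apply: (@leq_trans (8 ^ k * nb x ^ k)%N); first by rewrite -expnMn leq_expW.
  rewrite -mulnA leq_mul2l IHx ?orbT //.
  by move: bigU; rewrite expnS; nia.
rewrite expnS; apply: leq_trans (leq_mul U1P (leqnn _)) _.
rewrite -mulnA; apply: leq_trans (leq_mul (leqnn 8) step) _.
rewrite !mulnA leq_mul2r; apply/orP; right.
rewrite -expnS -expnD leq_exp2l //; lia.
Qed.

Lemma indep_exists k (U : {set F}) : (4 * 8 ^ k * m <= #|U|)%N ->
  exists2 t : k.-tuple F, all (mem U) t & pairwise nadj t.
Proof.
move=> bigU; have := indep_many bigU.
have u0 : (0 < #|U| ^ k)%N.
  rewrite expn_gt0; apply/orP; left; apply: leq_trans bigU.
  by rewrite !muln_gt0 expn_gt0 /=; have := m_gt2; lia.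
move=> /(leq_trans u0); rewrite muln_gt0 => /andP[_ /card_gt0P[t]].
by rewrite inE => /andP[]; exists t.
Qed.

(* Double counting of the pairs [(v, t)] with [t] an independent [s]-tuple in the
   neighbourhood of [v]; vertices of degree at most [d] give the first term. *)
Lemma biclique_bound (s r d : nat) (E : {set F * F}) : (0 < s)%N ->
  (forall (t : s.-tuple F) (u : r.-tuple F), pairwise nadj t -> pairwise nadj u ->
     exists x y, [/\ x \in t, y \in u & (y, x) \notin E]) ->
  (4 * 8 ^ s * m <= d)%N ->
  (#|E| * d ^ s.-1 <= m ^ 2 * d ^ s + 8 ^ (s * s) * ((m ^ 2) ^ s * (4 * 8 ^ r * m)))%N.
Proof.
move=> s0 free bigd; pose NE v := [set y | (v, y) \in E].
have cE : (#|E| = \sum_v #|NE v|)%N.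
  rewrite -sum1_card (eq_bigl (fun p : F * F => predT p.1 && ((p.1, p.2) \in E))); last first.
    by case.
  rewrite -(pair_big_dep predT (fun x y => (x, y) \in E) (fun _ _ => 1%N)) /=.
  by apply: eq_bigr => x _; rewrite sum1dep_card.
have low v : (#|NE v| * d ^ s.-1 <= d ^ s + 8 ^ (s * s) * #|indep s (NE v)|)%N.
  have dS : (d ^ s = d * d ^ s.-1)%N by rewrite -expnS prednK.
  have [le|/ltnW ge] := leqP #|NE v| d.
    by rewrite dS (leq_trans _ (leq_addr _ _)) // leq_mul2r le orbT.
  apply: leq_trans (leq_addl _ _).
  apply: leq_trans (indep_many (leq_trans bigd ge)).
  by rewrite -[X in (_ <= _ ^ X)%N](prednK s0) expnS leq_mul2l leq_expW ?orbT.
(* If too many vertices had all of [t] in their neighbourhoods, they would contain an independent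
   [r]-tuple, against [free]. *)
have high : (\sum_v #|indep s (NE v)| <= (m ^ 2) ^ s * (4 * 8 ^ r * m))%N.
  under eq_bigr => v _ do rewrite -sum1dep_card.
  rewrite (exchange_big_dep (fun t : s.-tuple F => pairwise nadj t)) /=; last first.
    by move=> v t _ /andP[].
  have -> : ((m ^ 2) ^ s = #|{: s.-tuple F}|)%N by rewrite card_tuple cardF.
  rewrite -sum_nat_const [X in (X <= _)%N]big_mkcond /=; apply: leq_sum => t _.
  case: ifP => // pt; rewrite sum1dep_card leqNgt; apply/negP => /ltnW/indep_exists[u au pu].
  have [x [y [xt yu /negP[]]]] := free t u pt pu.
  by have := allP au y yu; rewrite !inE => /andP[/allP/(_ x xt)]; rewrite /= inE.
rewrite cE big_distrl /=; apply: leq_trans (leq_sum _ (fun v _ => low v)) _.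
rewrite big_split /= sum_nat_const cardF leq_add2l -big_distrr /= leq_mul2l.
by rewrite high orbT.
Qed.

End IndependentTuples.

(** * Lower bound construction *)

(** Transport of the norm graph along an injection into [V], later the set of coset labels. Points
    outside the image are isolated, so a tuple with a common neighbour comes from the original
    graph. *)
Lemma norm_graph_in (s : nat) : (0 < s)%N ->
  exists D : nat, forall k (T : finType) (V : {set T}), (0 < k)%N ->
  (2 ^ (k * s) <= #|V|)%N -> exists h : rel T,
  [/\ symmetric h, irreflexive h, (forall x y, h x y -> x \in V),
   (2 ^ (k * s) * 2 ^ (k * s.-1) <= #|[set p : T * T | h p.1 p.2]|)%N &
   forall y : 'I_s -> T, injective y -> (#|[set z | [forall i, h z (y i)]]| <= D)%N].
Proof.
move=> s0; have [D HD] := norm_graph s0; exists D => k T V k0 leV.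
have [L [e [cardL esym eirr arcs bic]]] := HD k k0.
rewrite -cardL in leV.
pose io (z : L) : T := enum_val (widen_ord leV (enum_rank z)).
have io_inj : injective io.
  by move=> u v /enum_val_inj/(congr1 val) /= /val_inj/enum_rank_inj.
have ioV z : io z \in V by apply: enum_valP.
pose h : rel T := fun x y => [exists u, [exists v, [&& io u == x, io v == y & e u v]]].
have hP x y : reflect (exists u v, [/\ io u = x, io v = y & e u v]) (h x y).
  apply: (iffP existsP) => [[u /existsP[v /and3P[/eqP ? /eqP ? ?]]]|[u [v [? ? ?]]]].
    by exists u, v.
  by exists u; apply/existsP; exists v; apply/and3P; split=> //; apply/eqP.
have hio u v : h (io u) (io v) = e u v.
  apply/hP/idP => [[u' [v' [/io_inj-> /io_inj->]]] //|euv].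
  by exists u, v.
exists h; split.
- move=> x y; apply/hP/hP => -[u [v [? ? euv]]]; exists v, u; split=> //; by rewrite esym.
- move=> x; apply/hP => -[u [v [ux vx]]]; have -> : u = v by apply: io_inj; rewrite ux vx.
  by rewrite eirr.
- by move=> x y /hP[u [v [<- _ _]]].
- apply: leq_trans arcs _.
  have inj : injective (fun p : L * L => (io p.1, io p.2)).
    by move=> [a b] [a' b'] /= [/io_inj-> /io_inj->].
  rewrite -(card_imset _ inj); apply/subset_leq_card/subsetP => q /imsetP[p].
  by rewrite !inE => ep ->; rewrite hio.
move=> y yinj; set S := [set z | _].
have [->|[z0 z0S]] := set_0Vmem S; first by rewrite cards0.
have yin i : exists v, io v == y i.
  by move: z0S; rewrite inE => /forallP/(_ i)/hP[u [v [_ /eqP ? _]]]; exists v.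
pose y' i := xchoose (yin i).
have y'E i : io (y' i) = y i by apply/eqP; apply: (xchooseP (yin i)).
have y'inj : injective y'.
  by move=> i j E; apply: yinj; rewrite -!y'E E.
apply: leq_trans (bic y' y'inj); rewrite -(card_imset _ io_inj).
apply/subset_leq_card/subsetP => z; rewrite inE => /forallP hz.
have /hP[u [_ [uz _ _]]] := hz (Ordinal s0).
apply/imsetP; exists u => //; rewrite inE; apply/forallP => i.
by rewrite -hio y'E uz.
Qed.

Lemma mem_paley (F : finFieldType) (x y : F) :
  ((x, y) \in paley F) = (x != y) && issq (x - y).
Proof. by rewrite inE. Qed.

Section LowerGraph.
Variables (F : finFieldType) (m : nat).
Hypotheses (cardF : #|F| = (m ^ 2)%N) (oddm : odd m).
Variables (s D : nat) (h : rel F).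
Hypotheses (hsym : symmetric h) (hirr : irreflexive h)
  (hlabs : forall x y, h x y -> x \in labs F m)
  (hbic : forall y : 'I_s -> F, injective y ->
     (#|[set z | [forall i, h z (y i)]]| <= D)%N).

Definition blowup : {set F * F} :=
  [set p | (p \in paley F) && ((lab m p.1 == lab m p.2) || h (lab m p.1) (lab m p.2))].

Lemma mem_blowup x y : ((x, y) \in blowup) =
  [&& x != y, issq (x - y) & (lab m x == lab m y) || h (lab m x) (lab m y)].
Proof. by rewrite inE mem_paley andbA. Qed.

Lemma blowup_paley : blowup \subset paley F.
Proof. by apply/subsetP => p; rewrite inE => /andP[]. Qed.

Lemma blowup_simple : simple_graph blowup.
Proof.
apply/andP; split; first by apply/forallP => x; rewrite mem_blowup eqxx.
apply/forallP => x; apply/forallP => y; apply/eqP.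
by rewrite !mem_blowup eq_sym -(issqN cardF oddm) opprB [lab m x == _]eq_sym hsym.
Qed.

Lemma blowup_lab x y : x != y -> (x, y) \notin blowup -> lab m x != lab m y.
Proof.
move=> xy; apply: contraNneq => lxy; rewrite mem_blowup xy lxy eqxx andbT /=.
by apply: (issq_subk cardF oddm); rewrite subkE (labB cardF oddm) lxy subrr.
Qed.

(** Cosets are cliques, so each side of an induced copy has distinct labels. A label of the larger
    side either occurs on the smaller one or is a common [h]-neighbour of its [s] labels, which
    allows at most [s + D] labels. *)
Lemma blowup_free r : (s + D < r)%N -> ~ induced_sub (Kbip s r) blowup.
Proof.
move=> ltr [phi [phi_inj phiE]].
pose a i := lab m (phi (inl i)); pose b j := lab m (phi (inr j)).
have ainj : injective a.
  move=> i j; apply: contra_eq => ij; apply: blowup_lab.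
    by apply: contraNneq ij => /phi_inj[->].
  by rewrite -phiE inE.
have binj : injective b.
  move=> i j; apply: contra_eq => ij; apply: blowup_lab.
    by apply: contraNneq ij => /phi_inj[->].
  by rewrite -phiE inE.
have : (#|[set b j | j : 'I_r]| <= #|[set a i | i : 'I_s] :|: [set z | [forall i, h z (a i)]]|)%N.
  apply/subset_leq_card/subsetP => z /imsetP[j _ ->]; rewrite inE.
  have [//|/= /imsetP nA] := boolP (b j \in _); rewrite inE; apply/forallP => i.
  have : (phi (inr j), phi (inl i)) \in blowup by rewrite -phiE inE.
  rewrite mem_blowup => /and3P[_ _ /orP[/eqP E|//]].
  by case: nA; exists i.
rewrite card_imset // card_ord leqNgt => /negP[]; apply: leq_ltn_trans ltr.
apply: leq_trans (leq_card_setU _ _) _; rewrite leq_add ?hbic //.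
by rewrite card_imset // card_ord.
Qed.

Lemma card_blowup :
  (#|[set p : F * F | h p.1 p.2]| * (m * m.-1) <= 2 * #|blowup|)%N.
Proof.
pose f (p : F * F) := (lab m p.1, lab m p.2).
set H := [set p : F * F | h p.1 p.2].
pose S := [set p | h (lab m p.1) (lab m p.2) && issq (p.1 - p.2)].
have SG : S \subset blowup.
  apply/subsetP => -[x y]; rewrite mem_blowup inE /= => /andP[hxy ->].
  by rewrite hxy orbT /= andbT; apply: contraTneq hxy => ->; rewrite hirr.
apply: leq_trans (leq_mul (leqnn 2) (subset_leq_card SG)).
rewrite -[X in (_ <= _ * X)%N]sum1_card (partition_big f (mem H)) /=; last first.
  by move=> p; rewrite !inE => /andP[].
rewrite -sum_nat_const big_distrr /=; apply: leq_sum => -[l l'].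
rewrite inE /= => hll; rewrite sum1dep_card.
have ll : l != l' by apply: contraTneq hll => ->; rewrite hirr.
have lV : l \in labs F m := hlabs hll.
have l'V : l' \in labs F m by apply: (@hlabs _ l); rewrite hsym.
have dV := labs_sub cardF oddm lV l'V.
have d0 : l - l' != 0 by rewrite subr_eq0.
pose g (p : F * F) := (p.1 + p.2, p.2).
(* Pairs are parametrised by their difference, a square labelled [l - l'], and their second entry,
   labelled [l']. *)
have ginj : injective g by move=> [x y] [x' y'] /= [E yy]; move: E; rewrite yy => /addIr->.
apply: (@leq_trans (2 * #|g @: setX (sqfib m (l - l')%R) [set y | lab m y == l']|)%N).
  rewrite card_imset // cardsX (card_lab_fiber cardF oddm l'V) mulnA mul2n.
  by rewrite [(m * _)%N]mulnC leq_mul2r (card_sqfib cardF oddm dV d0) orbT.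
rewrite leq_mul2l /=; apply/subset_leq_card/subsetP => q /imsetP[[z y]].
rewrite !inE /= => /andP[/andP[sz /eqP zl] /eqP yl] ->.
by rewrite /g /f /= (labD cardF) zl yl subrK hll eqxx addrK sz.
Qed.

End LowerGraph.

(** * Upper bound and conclusion *)

Lemma pairwise_sym_in (T : eqType) (e : rel T) (t : seq T) : symmetric e ->
  pairwise e t -> {in t &, forall x y, x != y -> e x y}.
Proof.
move=> esym; elim: t => // z t IH /= /andP[/allP ez pt] x y.
rewrite !in_cons => /orP[/eqP->|xt] /orP[/eqP->|yt]; rewrite ?eqxx // => xy.
- exact: ez.
- by rewrite esym ez.
- exact: IH.
Qed.

Section UpperBound.
Variables (F : finFieldType) (m : nat).
Hypotheses (cardF : #|F| = (m ^ 2)%N) (oddm : odd m).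

Lemma nadj_sym : symmetric (@nadj F).
Proof. by move=> x y; rewrite /nadj -(issqN cardF oddm) opprB. Qed.

Lemma nadj_uniq (t : seq F) : pairwise (@nadj F) t -> uniq t.
Proof.
rewrite uniq_pairwise; apply: sub_pairwise => x y; apply: contraNneq => ->.
apply: (issq_subk cardF oddm); rewrite subkE subrr /lab expr0n subr0.
by rewrite gtn_eqF // (leq_trans _ (sqrt_card_gt2 cardF oddm)).
Qed.

Lemma nadj_paley (t : seq F) : pairwise (@nadj F) t ->
  {in t &, forall x y, (x, y) \notin paley F}.
Proof.
move=> pt x y xt yt; rewrite mem_paley negb_and negbK.
have [//|xy] := eqVneq x y.
exact: pairwise_sym_in nadj_sym pt _ _ xt yt xy.
Qed.

(** Non-adjacency in the Paley graph passes to the subgraph [E], which makes both sides independent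
    and the copy induced. *)
Lemma induced_biclique s r (E : {set F * F}) (t : s.-tuple F) (u : r.-tuple F) :
  simple_graph E -> E \subset paley F ->
  pairwise (@nadj F) t -> pairwise (@nadj F) u ->
  (forall x y, x \in t -> y \in u -> (y, x) \in E) ->
  induced_sub (Kbip s r) E.
Proof.
move=> /andP[/forallP Eirr /forallP Esym] /subsetP EP pt pu tu.
have {}Esym x y : ((x, y) \in E) = ((y, x) \in E) by apply/eqP; have /forallP := Esym x.
exists (fun w => match w with inl i => tnth t i | inr j => tnth u j end); split.
  have neq i j : tnth t i <> tnth u j.
    move=> ij; have := tu _ _ (mem_tnth i t) (mem_tnth j u).
    by rewrite ij; apply/negP/Eirr.
  move=> [i|i] [j|j] //.
  - by move/(tuple_uniqP _ (nadj_uniq pt)) => ->.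
  - by move/neq.
  - by move/esym/neq.
  - by move/(tuple_uniqP _ (nadj_uniq pu)) => ->.
have nE (w : seq F) x y : pairwise (@nadj F) w -> x \in w -> y \in w -> (x, y) \in E = false.
  by move=> pw xw yw; apply/negP => /EP; apply/negP; apply: (nadj_paley pw).
move=> [i|i] [j|j]; rewrite inE /=.
- by rewrite (nE t) ?mem_tnth.
- by rewrite Esym tu ?mem_tnth.
- by rewrite tu ?mem_tnth.
- by rewrite (nE u) ?mem_tnth.
Qed.

Lemma arcs_bound s r d (E : {set F * F}) : (0 < s)%N ->
  simple_graph E -> E \subset paley F -> ~ induced_sub (Kbip s r) E ->
  (4 * 8 ^ s * m <= d)%N ->
  (#|E| * d ^ s.-1 <= m ^ 2 * d ^ s + 8 ^ (s * s) * ((m ^ 2) ^ s * (4 * 8 ^ r * m)))%N.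
Proof.
move=> s0 sE EP free; apply: (biclique_bound cardF oddm) => // t u pt pu.
apply: contrapT => no; apply: free; apply: (induced_biclique sE EP pt pu) => x y xt yu.
by apply: contrapT => /negP nyx; apply: no; exists x, y.
Qed.

End UpperBound.

(** * Real exponents and optimisation of the degree threshold *)

Section Exponents.
Variables (R : realType) (s m : nat).
Hypotheses (s0 : (0 < s)%N) (m0 : (0 < m)%N).

(** For [n = m ^ 2] this is [n] to the power [1 / (2 * s)], so the target order becomes
    [m ^ 4 / sroot]. *)
Definition sroot : R := m%:R `^ (s%:R^-1).

Lemma sroot_gt0 : 0 < sroot.
Proof. by rewrite powR_gt0 // ltr0n. Qed.

Lemma sroot_exp : sroot ^+ s = m%:R.
Proof.
rewrite -powR_mulrn ?powR_ge0 // -powRrM mulVf ?powRr1 ?ler0n //.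
by rewrite pnatr_eq0 -lt0n.
Qed.

Lemma sroot_le : sroot <= m%:R.
Proof.
have P0 := sroot_gt0; have P1 : 1 <= sroot.
  rewrite -(ler_pXn2r s0) ?nnegrE ?ler01 ?(ltW P0) //.
  by rewrite sroot_exp expr1n ler1n.
by rewrite -sroot_exp -[X in X <= _]expr1 ler_weXn2l.
Qed.

Lemma powR_exponent :
  (m ^ 2)%:R `^ (2 - (2 * s)%:R^-1) = m%:R ^+ 4 / sroot :> R.
Proof.
have mR : 0 < (m%:R : R) by rewrite ltr0n.
have sR : (s%:R : R) != 0 by rewrite pnatr_eq0 -lt0n.
rewrite natrX -powR_mulrn ?ler0n // -powRrM.
have -> : 2%:R * (2 - (2 * s)%:R^-1) = 4%:R - s%:R^-1 :> R.
  by rewrite natrM; field.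
rewrite powRD ?(gt_eqF mR) ?implybT //.
by rewrite powR_mulrn ?ler0n // powRN.
Qed.

End Exponents.

(** Writing [P] for the root, [m ^ 2 / P = P ^ (2 * s - 1)] and [P <= 2 ^ k.+1]; rounding to a power
    of two thus costs the factor [2 ^ (2 * s).-1]. *)
Lemma lower_real (R : realType) (s m k ne : nat) : (0 < s)%N -> (0 < m)%N ->
  (m < (2 ^ k.+1) ^ s)%N ->
  (2 ^ (k * s) * 2 ^ (k * s.-1) * m ^ 2 <= 9 * ne)%N ->
  (9 * 2 ^ (2 * s).-1)%:R^-1 * (m%:R ^+ 4 / sroot R s m) <= ne%:R.
Proof.
move=> s0 m0 mk le; set P := sroot R s m.
have P0 : 0 < P := sroot_gt0 R s m0.
have PE : P ^+ s = m%:R := sroot_exp R m s0.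
have Plt : P <= (2 ^ k.+1)%:R.
  rewrite -(ler_pXn2r s0) ?nnegrE ?ler0n ?(ltW P0) //.
  by rewrite PE -natrX ler_nat ltnW.
have e2 : ((2 * s).-1 = s + s.-1)%N by rewrite mul2n -addnn -subn1 -addnBA // subn1.
have TP : m%:R ^+ 2 / P = P ^+ (2 * s).-1.
  apply: (mulIf (lt0r_neq0 P0)); rewrite divfK ?gt_eqF // -exprSr prednK ?muln_gt0 //.
  by rewrite mulnC exprM PE.
have W : m%:R ^+ 2 / P <= (2 ^ (2 * s).-1)%:R * (2 ^ (k * s) * 2 ^ (k * s.-1))%:R.
  rewrite TP; apply: le_trans (lerXn2r _ _ _ Plt) _; rewrite ?nnegrE ?ler0n ?(ltW P0) //.
  rewrite -natrX -natrM ler_nat -expnD -mulnDr -e2 -expnM -expnD.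
  by rewrite mulSn.
rewrite ler_pdivrMl ?ltr0n ?muln_gt0 ?expn_gt0 //.
have -> : m%:R ^+ 4 / P = m%:R ^+ 2 / P * m%:R ^+ 2 by rewrite [RHS]mulrAC -exprD.
apply: le_trans (ler_wpM2r (exprn_ge0 2 (ler0n _ _)) W) _.
rewrite -!natrX -!natrM ler_nat.
have := leq_mul (leqnn (2 ^ (2 * s).-1)) le.
by rewrite mulnA [(2 ^ _ * (9 * _))%N]mulnCA !mulnA.
Qed.

(** The two terms balance for [d] near [T = m ^ 2 / P], because [(m ^ 2) ^ s * m = m ^ 2 * T ^ s].
    Rounding [T] up to [c] and taking [d = A * c] is admissible as [m <= T], and gives
    [T <= d <= 2 * A * T]. *)
Lemma upper_real (R : realType) (s m e A B : nat) : (0 < s)%N -> (0 < m)%N -> (0 < A)%N ->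
  (forall d, (A * m <= d)%N -> (e * d ^ s.-1 <= m ^ 2 * d ^ s + B * (m ^ 2) ^ s * m)%N) ->
  e%:R <= (2 * A + B)%:R * (m%:R ^+ 4 / sroot R s m).
Proof.
move=> s0 m0 A0 H; set P := sroot R s m.
have P0 : 0 < P := sroot_gt0 R s m0.
have PE : P ^+ s = m%:R := sroot_exp R m s0.
have Pm : P <= m%:R := sroot_le R s0 m0.
have mR : 1 <= (m%:R : R) by rewrite ler1n.
have mR0 : 0 < (m%:R : R) by rewrite ltr0n.
pose T := m%:R ^+ 2 / P.
have TP : T * P = m%:R ^+ 2 by rewrite divfK ?gt_eqF.
have mT : m%:R <= T by rewrite ler_pdivlMr // expr2 ler_wpM2l // ltW.
have T0 : 0 < T by apply: lt_le_trans mT.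
pose c := (Num.truncn T).+1; pose d := (A * c)%N.
have Tc : T < c%:R by apply: truncnS_gt.
have c2 : c%:R <= 2 * T.
  rewrite /c -natr1 mulrDl mul1r; apply: lerD; last exact: le_trans mT.
  by rewrite truncn_le ltW.
have Td : T <= d%:R.
  by rewrite /d natrM; apply: le_trans (ltW Tc) _; rewrite ler_peMl ?ler0n // ler1n.
have {}H : e%:R * d%:R ^+ s.-1 <=
    m%:R ^+ 2 * d%:R ^+ s + B%:R * (m%:R ^+ 2) ^+ s * m%:R :> R.
  rewrite -!natrX -!natrM -natrD ler_nat; apply: H.
  rewrite leq_mul2l -(ler_nat R); apply/orP; right.
  exact: le_trans (le_trans mT (ltW Tc)) _.
have d0 : 0 < (d%:R : R) := lt_le_trans T0 Td.
have dT : d%:R <= (2 * A)%:R * T.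
  by rewrite /d !natrM -mulrA mulrCA ler_wpM2l ?ler0n.
set Y := m%:R ^+ 4 / P.
have YE : Y = m%:R ^+ 2 * T by rewrite /Y /T mulrA -exprD.
have Y0 : 0 < Y by rewrite YE mulr_gt0 // exprn_gt0.
clearbody Y.
rewrite -(ler_pM2r (exprn_gt0 s.-1 d0)); apply: le_trans H _.
rewrite natrD !mulrDl; apply: lerD.
  have -> : d%:R ^+ s = d%:R * d%:R ^+ s.-1 :> R by rewrite -exprS prednK.
  rewrite mulrA ler_wpM2r ?exprn_ge0 ?ler0n //.
  by rewrite YE mulrCA ler_wpM2l ?exprn_ge0 ?ler0n.
rewrite -!mulrA ler_wpM2l ?ler0n //.
have -> : (m%:R ^+ 2) ^+ s * m%:R = Y * T ^+ s.-1.
  rewrite YE -mulrA -exprS prednK // -[in LHS]TP exprMn PE.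
  by rewrite -mulrA mulrC expr2.
by rewrite ler_wpM2l ?(ltW Y0) // lerXn2r ?nnegrE ?(ltW T0) ?ler0n.
Qed.

Theorem theorem1p6 :
  forall s : nat, (2 <= s)%N ->
  exists r0 : nat, forall r : nat, (s <= r)%N -> (r0 <= r)%N ->
  exists (c C : Rdefinitions.R) (n0 : nat), 0 < c /\ 0 < C /\
    forall F : finFieldType,
      (#|F| %% 4 = 1)%N -> (exists m : nat, #|F| = (m ^ 2)%N) -> (n0 <= #|F|)%N ->
      c * (#|F|%:R `^ (2 - (2 * s)%:R^-1)) <= (ex_ind_Ksr (paley F) s r)%:R /\
      (ex_ind_Ksr (paley F) s r)%:R <= C * (#|F|%:R `^ (2 - (2 * s)%:R^-1)).
Proof.
move=> s s2; have s0 : (0 < s)%N by apply: ltnW.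
have [D HD] := norm_graph_in s0.
(* One more than the number of labels available to the larger side of an induced copy in the
   construction. *)
exists (s + D).+1 => r _ ltr.
pose A := (4 * 8 ^ s)%N; pose B := (8 ^ (s * s) * (4 * 8 ^ r))%N.
have A0 : (0 < A)%N by rewrite muln_gt0 expn_gt0.
(* The threshold on the order gives [2 ^ s <= m], so that the exponent [k] of the norm graph is
   positive. *)
exists (9 * 2 ^ (2 * s).-1)%:R^-1, (2 * A + B)%:R, ((2 ^ s) ^ 2)%N.
split; first by rewrite invr_gt0 ltr0n muln_gt0 expn_gt0.
split; first by rewrite ltr0n addn_gt0 muln_gt0 A0.
move=> F F4 [m cardF]; rewrite cardF => big.
have oddm : odd m.
  have : odd #|F| by rewrite (divn_eq #|F| 4) F4 oddD oddM andbF.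
  by rewrite cardF oddX.
have m2 := sqrt_card_gt2 cardF oddm.
have m0 : (0 < m)%N by apply: leq_trans m2.
rewrite powR_exponent //; split.
  have sm : (2 ^ s <= m)%N by rewrite -(@leq_exp2r _ _ 2).
  have s1 : (1 < 2 ^ s)%N by rewrite -[X in (X < _)%N](expn0 2) ltn_exp2l.
  pose k := trunc_log (2 ^ s) m.
  have k0 : (0 < k)%N by rewrite trunc_log_gt0 s1 prednK ?expn_gt0.
  have /andP[km mk] := trunc_log_bounds s1 m0.
  have kV : (2 ^ (k * s) <= #|labs F m|)%N by rewrite card_labs // mulnC expnM.
  have [h [hsym hirr hlabs arcs hbic]] := HD k F (labs F m) k0 kV.
  pose G := blowup m h.
  apply: (@le_trans _ _ (nedges G)%:R); last first.
    rewrite ler_nat; apply: (leq_bigmax_cond (F := @nedges F)); apply/and3P; split.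
    - exact: blowup_simple.
    - exact: blowup_paley.
    - by apply/asboolP; apply: (blowup_free cardF oddm hbic).
  apply: (@lower_real _ _ _ k) => //; first by rewrite -expnM mulnC expnM.
  have := card_blowup cardF oddm hsym hirr hlabs; rewrite -/G /nedges.
  have : (0 < 2 ^ (k * s) * 2 ^ (k * s.-1))%N by rewrite muln_gt0 !expn_gt0.
  move: arcs; move: (2 ^ _ * 2 ^ _)%N => W arcs W0 cG.
  have {}cG : (W * (m * m.-1) <= 2 * #|G|)%N by apply: leq_trans cG; rewrite leq_mul2r arcs orbT.
  move: (divn_eq #|G| 2) (ltn_pmod #|G| (isT : 0 < 2)%N) cG.
  move: (#|G| %/ 2)%N (#|G| %% 2)%N #|G| => ne re g -> re2.
  case: (m) m2 => // n n2; rewrite /= -[(n.+1 ^ 2)%N]/(n.+1 * n.+1)%N => cG.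
  (* Halving may lose one arc: the count reads [W * m * (m - 1) <= 4 * ne + 2]. Since
     [2 * m <= 3 * (m - 1)], this gives [W * m ^ 2 <= 6 * ne + 3]; the bound [6] forces [1 <= ne],
     whence the factor [9]. *)
  have : (6 <= W * (n.+1 * n))%N.
    by apply: (@leq_trans (1 * (3 * 2))%N) => //; rewrite !leq_mul.
  nia.
apply: (big_ind (fun n : nat => n%:R <= _ :> Rdefinitions.R)).
- by rewrite mulr_ge0 ?divr_ge0 ?exprn_ge0 ?ler0n // ltW // sroot_gt0.
- by move=> a b la lb; rewrite /maxn; case: ifP.
move=> E /and3P[sE EP /asboolP free].
apply: (@le_trans _ _ #|E|%:R); first by rewrite ler_nat leq_div.
apply: upper_real => // d Ad; rewrite /B.
apply: leq_trans (arcs_bound cardF oddm s0 sE EP free Ad) _.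
by rewrite leq_add2l; apply: eq_leq; ring.
Qed.
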